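(* The proof system $\mathbb{LUT}$ is sound and complete with respect to the class of all (reflexive) frames: for every formula $\phi$ of the language $\mathbf{LUT}$, $\vdash\phi$ if and only if $\vDash\phi$.
   Context: Let $\mathbf{P}$ be a countably infinite set of propositional variables and $\mathbf{I}$ a finite set of agents. The language $\mathbf{LUT}$ is given by $\phi::= p\mid\neg\phi\mid(\phi\land\phi)\mid K_i\phi\mid[\phi]\phi\mid U_i\phi$ with $p\in\mathbf{P}$, $i\in\mathbf{I}$; $\mathbf{EL}$ is the fragment without $[\cdot]$ and $U_i$. Other Boolean connectives, $\top,\bot$ are defined as usual. A model is $\mathcal{M}=\langle S,\{R_i\}_{i\in\mathbf{I}},V\rangle$ with $S\neq\emptyset$, each $R_i\subseteq S\times S$ reflexive, and $V:\mathbf{P}\to 2^S$; a frame is a model without valuation. Truth: $\mathcal{M},s\vDash p$ iff $s\in V(p)$; Boolean clauses as usual; $\mathcal{M},s\vDash K_i\phi$ iff $\mathcal{M},t\vDash\phi$ for all $t$ with $sR_it$; $\mathcal{M},s\vDash[\psi]\phi$ iff ($\mathcal{M},s\vDash\psi$ implies $\mathcal{M}|_\psi,s\vDash\phi$), where $\mathcal{M}|_\psi$ is the restriction of $\mathcal{M}$ (domain, relations, valuation) to the states where $\psi$ is true; $\mathcal{M},s\vDash U_i\phi$ iff $\mathcal{M},s\vDash\phi$ and for all $\psi\in\mathbf{EL}$, $\mathcal{M},s\vDash[\psi]\neg K_i\phi$. $\vDash\phi$ means $\phi$ is true at every state of every such model. Admissible forms are defined by $\eta(\sharp)::=\sharp\mid\phi\to\eta(\sharp)\mid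 K_i\eta(\sharp)\mid[\phi]\eta(\sharp)$ ($\phi\in\mathbf{LUT}$), and $\eta(\chi)$ denotes the formula obtained by replacing the placeholder $\sharp$ by $\chi$. The proof system $\mathbb{LUT}$ has axioms: all instances of propositional tautologies; $K_i(\phi\to\psi)\to(K_i\phi\to K_i\psi)$; $[\chi](\phi\to\psi)\to([\chi]\phi\to[\chi]\psi)$; $K_i\phi\to\phi$; $[\psi]p\leftrightarrow(\psi\to p)$; $[\psi]\neg\phi\leftrightarrow(\psi\to\neg[\psi]\phi)$; $[\psi](\phi\land\chi)\leftrightarrow([\psi]\phi\land[\psi]\chi)$; $[\psi]K_i\phi\leftrightarrow(\psi\to K_i[\psi]\phi)$; $[\psi][\chi]\phi\leftrightarrow[\psi\land[\psi]\chi]\phi$; and $U_i\phi\to\phi\land[\psi]\neg K_i\phi$ for every $\psi\in\mathbf{EL}$; and rules: modus ponens; from $\phi$ infer $K_i\phi$; from $\phi$ infer $[\chi]\phi$; and the infinitary rule RU: from $\eta(\phi\land[\psi]\neg K_i\phi)$ for all $\psi\in\mathbf{EL}$, infer $\eta(U_i\phi)$, for any admissible form $\eta$. $\vdash\phi$ means $\phi$ is a theorem of $\mathbb{LUT}$. *)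

(* Defs.v *)
From Corelib Require Import Setoid.
From mathcomp Require Import all_boot.
Set Implicit Arguments.
Unset Strict Implicit.
Unset Printing Implicit Defensive.

(* [LAnn psi phi] is the announcement formula [psi]phi. *)
Inductive LUT (P I : Type) : Type :=
| LVar (p : P)
| LNeg (phi : LUT P I)
| LAnd (phi psi : LUT P I)
| LK (i : I) (phi : LUT P I)
| LAnn (psi phi : LUT P I)
| LU (i : I) (phi : LUT P I).

Inductive EL (P I : Type) : Type :=
| EVar (p : P)
| ENeg (phi : EL P I)
| EAnd (phi psi : EL P I)
| EK (i : I) (phi : EL P I).

Arguments LVar {P I}.
Arguments EVar {P I}.

(* EL is a type of its own, because the clause for U_i in [sat] quantifies over
   all EL formulas; this embedding exhibits it as a fragment of LUT. *)
Fixpoint EL_LUT (P I : Type) (phi : EL P I) : LUT P I :=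
  match phi with
  | EVar p => LVar p
  | ENeg a => LNeg (EL_LUT a)
  | EAnd a b => LAnd (EL_LUT a) (EL_LUT b)
  | EK i a => LK i (EL_LUT a)
  end.
Coercion EL_LUT : EL >-> LUT.

Definition LImp (P I : Type) (a b : LUT P I) : LUT P I := LNeg (LAnd a (LNeg b)).
Definition LIff (P I : Type) (a b : LUT P I) : LUT P I :=
  LAnd (LImp a b) (LImp b a).

(* The formula phi /\ [psi]~K_i phi. *)
Definition LUinst (P I : Type) (i : I) (phi psi : LUT P I) : LUT P I :=
  LAnd phi (LAnn psi (LNeg (LK i phi))).

Record frame (I : Type) : Type := Frame {
  state :> Type;
  state_inh : inhabited state;
  acc : I -> state -> state -> Prop;
  acc_refl : forall i s, acc i s s
}.

Record model (P I : Type) : Type := Model {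
  model_frame :> frame I;
  val : P -> model_frame -> Prop
}.

Definition restrict_frame (I : Type) (F : frame I) (A : F -> Prop)
    (hA : exists s, A s) : frame I :=
  @Frame I {s : F | A s}
    (let: ex_intro s h := hA in inhabits (exist A s h))
    (fun i s t => acc i (sval s) (sval t))
    (fun i s => acc_refl i (sval s)).

Definition restrict (P I : Type) (M : model P I) (A : M -> Prop)
    (hA : exists s, A s) : model P I :=
  @Model P I (restrict_frame hA) (fun p s => val p (sval s)).

Fixpoint satEL (P I : Type) (M : model P I) (s : M) (phi : EL P I) : Prop :=
  match phi with
  | EVar p => val p s
  | ENeg a => ~ satEL s a
  | EAnd a b => satEL s a /\ satEL s b
  | EK i a => forall t : M, acc i s t -> satEL t a
  end.

(* In the last clause, [psi]~K_i phi is unfolded, as it is not a subformula of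
   U_i phi, and [satEL] is the truth of the EL formula psi: see [sat_EL_LUT]
   and [sat_LU] below. *)
Fixpoint sat (P I : Type) (M : model P I) (s : M) (phi : LUT P I) {struct phi} :
    Prop :=
  match phi with
  | LVar p => val p s
  | LNeg a => ~ sat s a
  | LAnd a b => sat s a /\ sat s b
  | LK i a => forall t : M, acc i s t -> sat t a
  | LAnn b a => forall h : sat s b,
      @sat P I (restrict (ex_intro (fun t : M => sat t b) s h))
           (exist (fun t : M => sat t b) s h) a
  | LU i a => sat s a /\
      forall (b : EL P I) (h : satEL s b),
        ~ (forall t : restrict (ex_intro (fun t : M => satEL t b) s h),
             acc i (exist (fun t : M => satEL t b) s h
                     : restrict (ex_intro (fun t : M => satEL t b) s h)) t ->
             @sat P I (restrict (ex_intro (fun t : M => satEL t b) s h)) t a)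
  end.

Definition valid (P I : Type) (phi : LUT P I) : Prop :=
  forall (M : model P I) (s : M), sat s phi.

Inductive aform (P I : Type) : Type :=
| AHole
| AImp (phi : LUT P I) (eta : aform P I)
| AK (i : I) (eta : aform P I)
| AAnn (phi : LUT P I) (eta : aform P I).

Fixpoint plug (P I : Type) (eta : aform P I) (chi : LUT P I) : LUT P I :=
  match eta with
  | AHole => chi
  | AImp phi eta' => LImp phi (plug eta' chi)
  | AK i eta' => LK i (plug eta' chi)
  | AAnn phi eta' => LAnn phi (plug eta' chi)
  end.

Inductive pform : Type :=
| PVar (n : nat)
| PNeg (a : pform)
| PAnd (a b : pform).

Fixpoint peval (v : nat -> bool) (a : pform) : bool :=
  match a with
  | PVar n => v n
  | PNeg b => ~~ peval v b
  | PAnd b c => peval v b && peval v c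
  end.

Definition tautology (a : pform) : Prop := forall v, peval v a.

Fixpoint psubst (P I : Type) (f : nat -> LUT P I) (a : pform) : LUT P I :=
  match a with
  | PVar n => f n
  | PNeg b => LNeg (psubst f b)
  | PAnd b c => LAnd (psubst f b) (psubst f c)
  end.

Inductive provable (P I : Type) : LUT P I -> Prop :=
| ax_taut (a : pform) (f : nat -> LUT P I) :
    tautology a -> provable (psubst f a)
| ax_KK i phi psi :
    provable (LImp (LK i (LImp phi psi)) (LImp (LK i phi) (LK i psi)))
| ax_annK chi phi psi :
    provable (LImp (LAnn chi (LImp phi psi)) (LImp (LAnn chi phi) (LAnn chi psi)))
| ax_T i phi : provable (LImp (LK i phi) phi)
| ax_ann_var psi p : provable (LIff (LAnn psi (LVar p)) (LImp psi (LVar p)))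
| ax_ann_neg psi phi :
    provable (LIff (LAnn psi (LNeg phi)) (LImp psi (LNeg (LAnn psi phi))))
| ax_ann_and psi phi chi :
    provable (LIff (LAnn psi (LAnd phi chi)) (LAnd (LAnn psi phi) (LAnn psi chi)))
| ax_ann_K psi i phi :
    provable (LIff (LAnn psi (LK i phi)) (LImp psi (LK i (LAnn psi phi))))
| ax_ann_ann psi chi phi :
    provable (LIff (LAnn psi (LAnn chi phi)) (LAnn (LAnd psi (LAnn psi chi)) phi))
| ax_U i phi (psi : EL P I) : provable (LImp (LU i phi) (LUinst i phi psi))
| rule_MP phi psi : provable (LImp phi psi) -> provable phi -> provable psi
| rule_NK i phi : provable phi -> provable (LK i phi)
| rule_Nann chi phi : provable phi -> provable (LAnn chi phi)
| rule_RU (eta : aform P I) i phi :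
    (forall psi : EL P I, provable (plug eta (LUinst i phi psi))) ->
    provable (plug eta (LU i phi)).

Lemma sat_EL_LUT (P I : Type) (M : model P I) (phi : EL P I) (s : M) :
  sat s phi <-> satEL s phi.
Proof.
elim: phi s => [p|a IHa|a IHa b IHb|i a IHa] s /=.
- by [].
- by rewrite IHa.
- by rewrite IHa IHb.
- by split=> h t st; apply/IHa/h.
Qed.

Definition bisimulation (P I : Type) (M N : model P I) (Z : M -> N -> Prop) : Prop :=
  [/\ forall s t, Z s t -> forall p, val p s <-> val p t,
      forall i s t s', Z s t -> acc i s s' -> exists2 t', acc i t t' & Z s' t'
    & forall i s t t', Z s t -> acc i t t' -> exists2 s', acc i s s' & Z s' t'].

Lemma satEL_bisim (P I : Type) (M N : model P I) (Z : M -> N -> Prop) :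
  bisimulation Z -> forall phi s t, Z s t -> satEL s phi <-> satEL t phi.
Proof.
move=> [hp hf hb]; elim=> [p|a IHa|a IHa b IHb|i a IHa] s t st /=.
- exact: hp.
- by rewrite (IHa _ _ st).
- by rewrite (IHa _ _ st) (IHb _ _ st).
- split=> h u su.
  + by have [v /h hv vu] := hb _ _ _ _ st su; apply/(IHa _ _ vu).
  + by have [v /h hv vu] := hf _ _ _ _ st su; apply/(IHa _ _ vu).
Qed.

Lemma bisim_restrict (P I : Type) (M N : model P I) (Z : M -> N -> Prop)
    (A : M -> Prop) (B : N -> Prop) (hA : exists s, A s) (hB : exists t, B t) :
  bisimulation Z -> (forall s t, Z s t -> A s <-> B t) ->
  bisimulation (fun (s : restrict hA) (t : restrict hB) => Z (sval s) (sval t)).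
Proof.
move=> [hp hf hb] AB; split.
- by move=> [s As] [t Bt] /= st p; apply: hp.
- move=> i [s As] [t Bt] [s' As'] /= st ss'.
  have [t' tt' st'] := hf _ _ _ _ st ss'.
  by exists (exist _ t' (proj1 (AB _ _ st') As')).
- move=> i [s As] [t Bt] [t' Bt'] /= st tt'.
  have [s' ss' st'] := hb _ _ _ _ st tt'.
  by exists (exist _ s' (proj2 (AB _ _ st') Bt')).
Qed.

Lemma sat_bisim (P I : Type) (phi : LUT P I) (M N : model P I) (Z : M -> N -> Prop) :
  bisimulation Z -> forall s t, Z s t -> sat s phi <-> sat t phi.
Proof.
elim: phi M N Z => [p|a IHa|a IHa b IHb|i a IHa|b IHb a IHa|i a IHa] M N Z bZ
  s t st /=; have [hp hf hb] := bZ.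
- exact: hp.
- by rewrite (IHa _ _ _ bZ _ _ st).
- by rewrite (IHa _ _ _ bZ _ _ st) (IHb _ _ _ bZ _ _ st).
- split=> h u su.
  + by have [v /h hv vu] := hb _ _ _ _ st su; apply/(IHa _ _ _ bZ _ _ vu).
  + by have [v /h hv vu] := hf _ _ _ _ st su; apply/(IHa _ _ _ bZ _ _ vu).
- have e := IHb _ _ _ bZ; split=> h k.
  + have k' := proj2 (e _ _ st) k.
    by apply: (proj1 (IHa _ _ _ (bisim_restrict _ _ bZ e) _ _ _)) (h k').
  + have k' := proj1 (e _ _ st) k.
    by apply: (proj2 (IHa _ _ _ (bisim_restrict _ _ bZ e) _ _ _)) (h k').
- rewrite (IHa _ _ _ bZ _ _ st).
  split=> -[sa h]; split=> // b k hk.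
  + have e := satEL_bisim bZ b.
    have k' := proj2 (e _ _ st) k.
    have bR := bisim_restrict (ex_intro _ s k') (ex_intro _ t k) bZ e.
    apply: (h b k') => u su.
    have [_ hfR _] := bR.
    have [v tv uv] := hfR i (exist _ s k') (exist _ t k) u st su.
    exact/(IHa _ _ _ bR _ _ uv)/hk.
  + have e := satEL_bisim bZ b.
    have k' := proj1 (e _ _ st) k.
    have bR := bisim_restrict (ex_intro _ s k) (ex_intro _ t k') bZ e.
    apply: (h b k') => u tu.
    have [_ _ hbR] := bR.
    have [v sv vu] := hbR i (exist _ s k) (exist _ t k') u st tu.
    exact/(IHa _ _ _ bR _ _ vu)/hk.
Qed.

Lemma sat_LU (P I : Type) (M : model P I) (s : M) (i : I) (phi : LUT P I) :
  sat s (LU i phi) <->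
  sat s phi /\ forall psi : EL P I, sat s (LAnn psi (LNeg (LK i phi))).
Proof.
have bZ : bisimulation (fun x y : M => x = y).
  split=> [x _ <- //|j x _ x' <- xx'|j x _ x' <- xx']; by exists x'.
have e (b : EL P I) (x y : M) : x = y -> satEL x b <-> sat y b.
  by move=> <-; rewrite sat_EL_LUT.
split=> -[sa h]; split=> // b k hk.
- have k' := proj2 (e b _ _ erefl) k.
  have bR := bisim_restrict (ex_intro _ s k') (ex_intro _ s k) bZ (e b).
  apply: (h b k') => u su; have [_ hfR _] := bR.
  have [v tv uv] := hfR i (exist _ s k') (exist _ s k) u erefl su.
  exact/(sat_bisim phi bR uv)/hk.
- have k' := proj1 (e b _ _ erefl) k.
  have bR := bisim_restrict (ex_intro _ s k) (ex_intro _ s k') bZ (e b).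
  apply: (h b k') => u tu; have [_ _ hbR] := bR.
  have [v sv vu] := hbR i (exist _ s k) (exist _ s k') u erefl tu.
  exact/(sat_bisim phi bR vu)/hk.
Qed.

(* Main.v *)
(** Soundness of RU holds because admissible forms commute with the infinite
  conjunction that defines U_i.  For completeness, call a set of formulas a
  theory if it contains all theorems and is closed under modus ponens and RU.
  Since the language is countable, a consistent theory extends to a maximal one:
  formulas are decided one at a time, and whenever eta(U_i phi) is rejected,
  some instance eta(phi /\ [psi]~K_i phi) is rejected with it, which keeps the
  limit closed under RU.  In the canonical model on maximal theories, the truth
  lemma follows by lexicographic induction on U-depth and then on a rank that
  decreases along the reduction axioms for announcements.  [psi]U_i phi has no
  reduction axiom, but it is itself an admissible form, so in a maximal theory
  it is equivalent to all [psi](phi /\ [chi]~K_i phi) with chi in EL, which have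
  smaller U-depth. *)

Require Import Defs.
From mathcomp Require Import all_boot.
From mathcomp Require Import boolp zify.

Set Implicit Arguments.
Unset Strict Implicit.
Unset Printing Implicit Defensive.

(** * Soundness *)

Section Soundness.
Variables P I : Type.
Implicit Types (M : model P I) (phi psi chi a b : LUT P I).

Lemma sat_LImp M (s : M) a b : sat s (LImp a b) <-> (sat s a -> sat s b).
Proof.
split=> /= [h sa|h [sa]]; last by apply; apply: h.
by apply: contrapT => nb; apply: h.
Qed.

Lemma sat_LIff M (s : M) a b : sat s (LIff a b) <-> (sat s a <-> sat s b).
Proof.
split=> [[/sat_LImp h /sat_LImp k]|[h k]]; first by split.
by split; apply/sat_LImp.
Qed.

(** A restricted model carries a proof that its domain is nonempty. By proof irrelevance the choice
    of that proof does not affect truth. *)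
Lemma sat_restrict M (A : M -> Prop) (h h' : exists s, A s) (s : {s | A s}) phi :
  @sat P I (restrict h) s phi -> @sat P I (restrict h') s phi.
Proof. by rewrite (Prop_irrelevance h h'). Qed.

Lemma sat_LAnn M (s : M) psi phi (h : sat s psi) (hA : exists t : M, sat t psi) :
  sat s (LAnn psi phi) <-> @sat P I (restrict hA) (exist _ s h) phi.
Proof.
split=> [/(_ h)|k h'] /=; first exact: sat_restrict.
by rewrite (Prop_irrelevance h' h); apply: sat_restrict k.
Qed.

Lemma sat_LAnn_LK M (s : M) psi i phi :
  sat s (LAnn psi (LK i phi)) <->
  (sat s psi -> forall t, acc i s t -> sat t (LAnn psi phi)).
Proof.
split=> [h sp t st tp|h sp [t tp] /= st].
- exact: (sat_restrict _ (h sp (exist _ t tp) st)).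
- exact: (sat_restrict _ (h sp t st tp)).
Qed.

(** Restricting twice and restricting once to the conjunction give models whose states differ only
    in their attached proofs. They are not equal as types, but having the same underlying state is a
    bisimulation. *)
Lemma sat_LAnn_LAnn M (s : M) psi chi phi :
  sat s (LAnn psi (LAnn chi phi)) <-> sat s (LAnn (LAnd psi (LAnn psi chi)) phi).
Proof.
suff key (hp : exists t : M, sat t psi) (x : restrict hp) (xc : sat x chi)
    (hc : exists y : restrict hp, sat y chi)
    (ha : exists t : M, sat t (LAnd psi (LAnn psi chi)))
    (xa : sat (sval x) (LAnd psi (LAnn psi chi))) :
    @sat P I (restrict hc) (exist _ x xc) phi <->
    @sat P I (restrict ha) (exist _ (sval x) xa) phi.
  split=> h.
  - move=> sa; have [sp sc] := sa.
    exact: (proj1 (key _ (exist _ s sp) (sc sp) _ _ sa) (h sp (sc sp))).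
  - move=> sp sc.
    have sa : sat s (LAnd psi (LAnn psi chi)).
      by split; last exact: (proj2 (sat_LAnn _ _ _) sc).
    exact: (proj2 (key _ (exist _ s sp) sc _ _ sa) (h sa)).
have bZ : bisimulation (fun (u : restrict hc) (v : restrict ha) =>
    sval (sval u) = sval v); last exact: (sat_bisim phi bZ).
split.
- by move=> [[u ?] ?] [v ?] /= <-.
- move=> i [[u up] uc] [v va] [[w wp] wc] /= uv uw; subst v.
  have wa : sat w (LAnd psi (LAnn psi chi)).
    by split; last exact: (proj2 (sat_LAnn _ _ _) wc).
  by exists (exist _ w wa).
- move=> i [[u up] uc] [v va] [w wa] /= uv vw; subst v.
  have [wp wc] := wa.
  have wc' : @sat P I (restrict hp) (exist _ w wp) chi.
    exact: (proj1 (sat_LAnn _ _ _) wc).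
  by exists (exist _ (exist _ w wp) wc').
Qed.

(** The semantic counterpart of RU: implications, knowledge and announcements all commute with an
    infinite conjunction on the right. *)
Lemma sat_plug_LU (p0 : P) (eta : aform P I) i phi M (s : M) :
  sat s (plug eta (LU i phi)) <->
  forall psi : EL P I, sat s (plug eta (LUinst i phi psi)).
Proof.
elim: eta M s => [|a eta IH|j eta IH|a eta IH] M s.
- rewrite /plug sat_LU; split=> [[sa h] psi|h]; first by split.
  (* The conjunct [phi] is read off from one instance; [EVar p0] supplies an EL formula for it. *)
  by split=> [|psi]; [have [] := h (EVar p0)|have [] := h psi].
- rewrite [plug _ _]/(LImp a (plug eta _)) sat_LImp IH.
  split=> [h psi|h sa psi]; first by apply/sat_LImp => /h.
  by move/sat_LImp: (h psi); apply.
- split=> [h psi t st|h t st]; first by apply: (proj1 (IH _ _)); apply: h.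
  by apply/IH => psi; apply: h.
- split=> [h psi k|h k]; first by apply: (proj1 (IH _ _)); apply: h.
  by apply/IH => psi; apply: h.
Qed.

Lemma sat_psubst M (s : M) (f : nat -> LUT P I) (a : pform) :
  sat s (psubst f a) <-> peval (fun n => `[< sat s (f n) >]) a.
Proof.
elim: a => [n|a IH|a IHa b IHb] /=.
- by split=> /asboolP.
- by rewrite IH; split=> /negP.
- by rewrite IHa IHb; split=> /andP.
Qed.

Lemma soundness (p0 : P) phi : provable phi -> valid phi.
Proof.
elim=> {phi} [a f ta|i phi psi|chi phi psi|i phi|psi p|psi phi|psi phi chi
  |psi i phi|psi chi phi|i phi psi|phi psi _ h1 _ h2|i phi _ h|chi phi _ h
  |eta i phi _ h] M s.
- exact/sat_psubst/ta.
- apply/sat_LImp => h; apply/sat_LImp => k t st.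
  by move/sat_LImp: (h t st); apply; apply: k.
- apply/sat_LImp => h; apply/sat_LImp => k sc.
  by move/sat_LImp: (h sc); apply; apply: k.
- by apply/sat_LImp; apply; apply: acc_refl.
- by apply/sat_LIff; rewrite sat_LImp.
- apply/sat_LIff; rewrite sat_LImp; split=> [h sp|h sp].
  + by move=> k; apply: (h sp); apply: k.
  + by move=> k; apply: (h sp); apply: (proj2 (sat_LAnn _ _ _) k).
- apply/sat_LIff; split=> [h|[h k] sp]; last by split; [apply: h|apply: k].
  by split=> sp; case: (h sp).
- by apply/sat_LIff; rewrite sat_LImp sat_LAnn_LK.
- exact/sat_LIff/sat_LAnn_LAnn.
- by apply/sat_LImp => /sat_LU [sa h]; split.
- by move/sat_LImp: (h1 M s); apply.
- by move=> t _; apply: h.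
- by move=> sc; apply: h.
- by apply/(sat_plug_LU p0) => psi; apply: h.
Qed.

End Soundness.

(** * Theories *)

Section Theories.
Variables P I : Type.
Implicit Types (phi psi chi a b c : LUT P I) (G : LUT P I -> Prop).

(** Closure under necessitation is not demanded: a theory stands for the truths at a single
    state. *)
Record theory G : Prop := Theory {
  theory_thm : forall phi, provable phi -> G phi;
  theory_MP : forall phi psi, G (LImp phi psi) -> G phi -> G psi;
  theory_RU : forall (eta : aform P I) i phi,
    (forall psi : EL P I, G (plug eta (LUinst i phi psi))) ->
    G (plug eta (LU i phi))
}.

Lemma provable_theory : theory (@provable P I).
Proof.
split=> // [phi psi|eta i phi]; [exact: rule_MP|exact: rule_RU].
Qed.

(** RU survives because $K_i\eta$ is again an admissible form. This theory is the starting point for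
    building a successor in the canonical model. *)
Lemma theory_LK G i : theory G -> theory (fun phi => G (LK i phi)).
Proof.
move=> [thm MP RU]; split=> [phi h|phi psi h k|eta j phi h].
- exact/thm/rule_NK.
- by apply: (MP _ _ _ k); apply: (MP _ _ _ h); apply/thm/ax_KK.
- exact: (RU (AK i eta)).
Qed.

(** Mirrors [LImp], so that [psubst] turns it into an [LImp] by computation. *)
Definition pimp (x y : pform) : pform := PNeg (PAnd x (PNeg y)).

Lemma theory_taut G (x : pform) (s : seq (LUT P I)) (d : LUT P I) :
  theory G -> tautology x -> G (psubst (nth d s) x).
Proof. by move=> hG tx; apply: theory_thm => //; apply: ax_taut. Qed.

Local Notation p0 := (PVar 0).
Local Notation p1 := (PVar 1).
Local Notation p2 := (PVar 2).
Local Ltac taut :=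
  let v := fresh in
  intro v; simpl; repeat match goal with |- context [v ?n] => case (v n) end;
  done.

(** * Propositional reasoning inside a theory *)

Section Propositional.
Variable G : LUT P I -> Prop.
Hypothesis hG : theory G.
Let MP := theory_MP hG.

Lemma theory_imp_refl a : G (LImp a a).
Proof. by apply: (theory_taut (x := pimp p0 p0) [::] a hG); taut. Qed.

Lemma theory_weaken a b : G b -> G (LImp a b).
Proof.
apply/MP/(theory_taut (x := pimp p0 (pimp p1 p0)) [:: b; a] a hG); taut.
Qed.

Lemma theory_imp_trans a b c : G (LImp a b) -> G (LImp b c) -> G (LImp a c).
Proof.
move=> h; apply: (MP); apply: (MP) h.
apply: (theory_taut (x := pimp (pimp p0 p1) (pimp (pimp p1 p2) (pimp p0 p2)))
  [:: a; b; c] a hG); taut.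
Qed.

Lemma theory_imp_MP a b c :
  G (LImp c (LImp a b)) -> G (LImp c a) -> G (LImp c b).
Proof.
move=> h; apply: (MP); apply: (MP) h.
apply: (theory_taut (x := pimp (pimp p2 (pimp p0 p1))
  (pimp (pimp p2 p0) (pimp p2 p1))) [:: a; b; c] a hG); taut.
Qed.

Lemma theory_absurd a c : G (LImp c a) -> G (LImp c (LNeg a)) -> G (LNeg c).
Proof.
move=> h; apply: (MP); apply: (MP) h.
apply: (theory_taut (x := pimp (pimp p1 p0) (pimp (pimp p1 (PNeg p0))
  (PNeg p1))) [:: a; c] a hG); taut.
Qed.

Lemma theory_nand a b : G (LNeg (LAnd a b)) -> G (LImp a (LNeg b)).
Proof.
apply: (MP).
apply: (theory_taut (x := pimp (PNeg (PAnd p0 p1)) (pimp p0 (PNeg p1)))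
  [:: a; b] a hG); taut.
Qed.

Lemma theory_dneg a : G (LNeg (LNeg a)) -> G a.
Proof.
by apply/MP/(theory_taut (x := pimp (PNeg (PNeg p0)) p0) [:: a] a hG); taut.
Qed.

Lemma theory_and_l a b : G (LImp (LAnd a b) a).
Proof.
by apply: (theory_taut (x := pimp (PAnd p0 p1) p0) [:: a; b] a hG); taut.
Qed.

Lemma theory_and_r a b : G (LImp (LAnd a b) b).
Proof.
by apply: (theory_taut (x := pimp (PAnd p0 p1) p1) [:: a; b] a hG); taut.
Qed.

Lemma theory_and a b : G a -> G b -> G (LAnd a b).
Proof.
move=> h; apply: (MP); apply: (MP) h.
by apply: (theory_taut (x := pimp p0 (pimp p1 (PAnd p0 p1))) [:: a; b] a hG);
  taut.
Qed.

End Propositional.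

Lemma provable_plug_imp (eta : aform P I) a b :
  provable (LImp a b) -> provable (LImp (plug eta a) (plug eta b)).
Proof.
have T := provable_theory.
elim: eta => //= [c eta IH|i eta IH|c eta IH] /IH {}IH.
- apply: (theory_MP T) IH.
  apply: (theory_taut (x := pimp (pimp p0 p1) (pimp (pimp p2 p0) (pimp p2 p1)))
    [:: plug eta a; plug eta b; c] a T); taut.
- exact: rule_MP (ax_KK _ _ _) (rule_NK _ IH).
- exact: rule_MP (ax_annK _ _ _) (rule_Nann _ IH).
Qed.

(** No admissible form has $U_i$ as its head, so the hole can be located. Hence rejecting a formula
    requires a witness for at most one decomposition. *)
Lemma plug_LU_inj (eta eta' : aform P I) i i' phi phi' :
  plug eta (LU i phi) = plug eta' (LU i' phi') ->
  [/\ eta = eta', i = i' & phi = phi'].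
Proof.
elim: eta eta' => [|a eta IH|j eta IH|a eta IH] [|a' eta'|j' eta'|a' eta'] //=.
- by case.
- by case=> -> /IH [-> -> ->].
- by case=> -> /IH [-> -> ->].
- by case=> -> /IH [-> -> ->].
Qed.

(** * Maximal theories *)

Record maxtheory G : Prop := Maxtheory {
  maxtheory_theory :> theory G;
  maxtheory_cons : forall phi, G phi -> ~ G (LNeg phi);
  maxtheory_compl : forall phi, G phi \/ G (LNeg phi)
}.

Section MaximalTheories.
Variable G : LUT P I -> Prop.
Hypothesis mG : maxtheory G.
Let hG : theory G := mG.

Lemma maxtheory_LNeg a : G (LNeg a) <-> ~ G a.
Proof.
split=> [h k|h]; first exact: maxtheory_cons k h.
by case: (maxtheory_compl mG a).
Qed.

Lemma maxtheory_LAnd a b : G (LAnd a b) <-> G a /\ G b.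
Proof.
split=> [h|[]]; last exact: theory_and.
by split; apply: theory_MP h => //; [exact: theory_and_l|exact: theory_and_r].
Qed.

Lemma maxtheory_LIff a b : provable (LIff a b) -> G a <-> G b.
Proof.
by move=> /(theory_thm hG) /maxtheory_LAnd [h k]; split; apply: theory_MP.
Qed.

Lemma maxtheory_plug_LU (eta : aform P I) i phi :
  G (plug eta (LU i phi)) <->
  forall psi : EL P I, G (plug eta (LUinst i phi psi)).
Proof.
split=> [h psi|]; last exact: theory_RU.
by apply: theory_MP h => //; apply/(theory_thm hG)/provable_plug_imp/ax_U.
Qed.

End MaximalTheories.

(** * Countability of the language, by coding formulas as trees of naturals *)

Fixpoint LUT_tree (f : P -> nat) (g : I -> nat) phi : GenTree.tree nat :=
  match phi with
  | LVar p => GenTree.Leaf (f p)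
  | LNeg a => GenTree.Node 0 [:: LUT_tree f g a]
  | LAnd a b => GenTree.Node 1 [:: LUT_tree f g a; LUT_tree f g b]
  | LK i a => GenTree.Node 2 [:: GenTree.Leaf (g i); LUT_tree f g a]
  | LAnn a b => GenTree.Node 3 [:: LUT_tree f g a; LUT_tree f g b]
  | LU i a => GenTree.Node 4 [:: GenTree.Leaf (g i); LUT_tree f g a]
  end.

Lemma LUT_tree_inj (f : P -> nat) (g : I -> nat) :
  injective f -> injective g -> injective (LUT_tree f g).
Proof.
move=> finj ginj; elim=> [p|a IHa|a IHa b IHb|i a IHa|a IHa b IHb|i a IHa]
  [q|a'|a' b'|i' a'|a' b'|i' a'] //= [].
- by move=> /finj ->.
- by move=> /IHa ->.
- by move=> /IHa -> /IHb ->.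
- by move=> /ginj -> /IHa ->.
- by move=> /IHa -> /IHb ->.
- by move=> /ginj -> /IHa ->.
Qed.

(** * Extension of a consistent formula to a maximal theory *)

Section Lindenbaum.
Variables (code : LUT P I -> nat) (code_inj : injective code).
Variable G : LUT P I -> Prop.
Hypothesis hG : theory G.

Definition decides phi c : Prop :=
  G (LImp c phi) \/
  G (LImp c (LNeg phi)) /\
  forall eta i psi, phi = plug eta (LU i psi) ->
    exists chi : EL P I, G (LImp c (LNeg (plug eta (LUinst i psi chi)))).

Lemma decides_ext c phi : ~ G (LNeg c) ->
  exists c', [/\ ~ G (LNeg c'), G (LImp c' c) & decides phi c'].
Proof.
move=> nc; have [h|/contrapT h] := EM (~ G (LNeg (LAnd c phi))).
  exists (LAnd c phi); split=> //; first exact: theory_and_l.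
  by left; apply: theory_and_r.
have {}h := theory_nand hG h.
have [[[[eta i] psi] e]|nU] :=
  EM (exists x : aform P I * I * LUT P I, phi = plug x.1.1 (LU x.1.2 x.2)).
  (* Since $c\to\eta$ is itself admissible, having all instances in [G] would yield $c\to\phi$ by
     RU, against the consistency of [c]. *)
  have [chi nchi] : exists chi : EL P I,
      ~ G (plug (AImp c eta) (LUinst i psi chi)).
    apply/existsNP => /(theory_RU hG) /= k; apply: nc.
    by apply: (theory_absurd hG) h; rewrite e.
  (* Consistency of this formula is [nchi] itself, by the definition of [LImp]. *)
  exists (LAnd c (LNeg (plug eta (LUinst i psi chi)))); split=> //.
    exact: theory_and_l.
  right; split=> [|eta' i' psi' e'].
    exact: theory_imp_trans (theory_and_l hG _ _) h.
  have [<- <- <-] := plug_LU_inj (etrans (esym e) e').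
  by exists chi; apply: theory_and_r.
exists c; split=> //; first exact: theory_imp_refl.
right; split=> // eta i psi e; case: nU.
by exists (eta, i, psi).
Qed.

Lemma Lindenbaum c : ~ G (LNeg c) ->
  exists2 D, maxtheory D & D c /\ forall phi, G phi -> D phi.
Proof.
move=> nc.
(* The consistency hypothesis stands under the existential so that choice yields a total function
   [next]. *)
have step (x : nat * LUT P I) : exists c', ~ G (LNeg x.2) ->
    [/\ ~ G (LNeg c'), G (LImp c' x.2)
      & forall phi, code phi = x.1 -> decides phi c'].
  case: x => n a /=.
  have [k|] := EM (~ G (LNeg a)); last by exists a.
  have [[phi e]|ne] := EM (exists phi, code phi = n).
    have [c' [h1 h2 h3]] := decides_ext phi k.
    by exists c' => _; split=> // psi; rewrite -e => /code_inj ->.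
  exists a => _; split=> // [|phi e]; first exact: theory_imp_refl.
  by case: ne; exists phi.
have [next nextP] := choice step.
pose g := fix g n := if n is m.+1 then next (m, g m) else c.
have gcons n : ~ G (LNeg (g n)).
  by elim: n => //= n IH; case: (nextP (n, g n) IH).
have gmono n m : n <= m -> G (LImp (g m) (g n)).
  elim: m => [|m IH]; first by case: n => // _; apply: theory_imp_refl.
  rewrite leq_eqVlt => /orP [/eqP ->|/IH]; first exact: theory_imp_refl.
  by apply: theory_imp_trans => //; case: (nextP (m, g m) (gcons m)).
(* The formula with code [n] is treated in passing from stage [n] to stage [n.+1]. *)
have gdec phi : decides phi (g (code phi).+1).
  by case: (nextP (code phi, g (code phi)) (gcons _)) => _ _; apply.
pose D phi := exists n, G (LImp (g n) phi).
have DG phi : G phi -> D phi by exists 0; apply: theory_weaken.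
have Dcons phi : D phi -> ~ D (LNeg phi).
  move=> [n h] [m k]; apply: (gcons (maxn n m)).
  apply: (theory_absurd hG).
  - exact: (theory_imp_trans hG (gmono _ _ (leq_maxl n m)) h).
  - exact: (theory_imp_trans hG (gmono _ _ (leq_maxr n m)) k).
exists D; last by split=> //; exists 0; apply: theory_imp_refl.
split=> // [|phi]; last first.
  by have [h|[h _]] := gdec phi; [left|right]; exists (code phi).+1.
split=> [phi /(theory_thm hG) /DG //|phi psi [n h] [m k]|eta i phi h].
- exists (maxn n m); apply: (theory_imp_MP hG).
  + exact: (theory_imp_trans hG (gmono _ _ (leq_maxl n m)) h).
  + exact: (theory_imp_trans hG (gmono _ _ (leq_maxr n m)) k).
(* If the conclusion of RU had been rejected, the limit would contain the negation of one of its
   premises. *)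
- have [k|[_ /(_ _ _ _ erefl) [chi k]]] := gdec (plug eta (LU i phi)).
    by eexists; exact: k.
  by case: (Dcons _ (h chi)); eexists; exact: k.
Qed.

End Lindenbaum.
End Theories.

(** * The canonical model *)

Section Canonical.
Variables (P I : Type) (code : LUT P I -> nat) (code_inj : injective code).
Variables (p0 : P) (D0 : LUT P I -> Prop) (mD0 : maxtheory D0).
Implicit Types (phi psi a b : LUT P I).

Definition canonical_state := {D : LUT P I -> Prop | maxtheory D}.

Definition canonical_acc (i : I) (s t : canonical_state) : Prop :=
  forall phi, sval s (LK i phi) -> sval t phi.

Lemma canonical_acc_refl i s : canonical_acc i s s.
Proof.
by case: s => D mD phi; apply: (theory_MP mD); apply/(theory_thm mD)/ax_T.
Qed.

Definition canonical_model : model P I :=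
  @Model P I (@Frame I canonical_state (inhabits (exist _ D0 mD0))
               canonical_acc canonical_acc_refl)
    (fun p s => sval s (LVar p)).

Definition truth phi : Prop :=
  forall s : canonical_model, sat s phi <-> sval s phi.

Lemma truth_LNeg a : truth a -> truth (LNeg a).
Proof. by move=> h s; rewrite (maxtheory_LNeg (svalP s)) /= h. Qed.

Lemma truth_LAnd a b : truth a -> truth b -> truth (LAnd a b).
Proof. by move=> h k s; rewrite (maxtheory_LAnd (svalP s)) /= h k. Qed.

Lemma truth_LImp a b : truth a -> truth b -> truth (LImp a b).
Proof. by move=> h k; apply/truth_LNeg/truth_LAnd/truth_LNeg. Qed.

Lemma truth_LK i a : truth a -> truth (LK i a).
Proof.
move=> h s; split=> [k|k t st]; last exact/h/st.
apply: contrapT => nk.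
have hK := theory_LK i (svalP s).
have nn : ~ sval s (LK i (LNeg (LNeg a))) by move/(theory_dneg hK).
(* A maximal theory containing $\neg a$ and every $\phi$ with $K_i\phi$ in [s], hence accessible
   from [s]. *)
have [D mD [Da GD]] := Lindenbaum code_inj hK nn.
apply: (maxtheory_cons mD) Da.
exact: (proj1 (h (exist _ D mD)) (k (exist _ D mD) GD)).
Qed.

(** Membership transfers along a theorem by maximality, truth by soundness. This is how the
    reduction axioms enter the truth lemma. *)
Lemma truth_LIff a b : provable (LIff a b) -> truth b -> truth a.
Proof.
move=> e h s; rewrite (maxtheory_LIff (svalP s) e) -h.
exact/sat_LIff/(soundness p0).
Qed.

Lemma truth_plug_LU eta i a :
  (forall psi : EL P I, truth (plug eta (LUinst i a psi))) ->
  truth (plug eta (LU i a)).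
Proof.
move=> h s; rewrite (maxtheory_plug_LU (svalP s)) (sat_plug_LU p0).
by split=> k psi; apply/h.
Qed.

(* Announcements add up: [psi]U_i a must outrank every [psi][chi]~K_i a, where
   psi may itself contain U. *)
Fixpoint Udepth phi : nat :=
  match phi with
  | LVar _ => 0
  | LNeg a => Udepth a
  | LAnd a b => maxn (Udepth a) (Udepth b)
  | LK _ a => Udepth a
  | LAnn b a => Udepth b + Udepth a
  | LU _ a => (Udepth a).+1
  end.

(** The product handles composition. For $p,c$ the ranks of $\psi,\chi$, the factor of [rank a]
    drops from $(4+p)(4+c)$ in $[\psi][\chi]a$ to $5+p+(4+p)c$ in $[\psi\land[\psi]\chi]a$. *)
Fixpoint rank phi : nat :=
  match phi with
  | LVar _ => 1
  | LNeg a => (rank a).+1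
  | LAnd a b => (rank a + rank b).+1
  | LK _ a => (rank a).+1
  | LAnn b a => (4 + rank b) * rank a
  | LU _ a => (rank a).+1
  end.

Lemma rank_gt0 phi : 0 < rank phi.
Proof. by elim: phi => //= psi _ phi h; rewrite muln_gt0. Qed.

Lemma Udepth_EL (psi : EL P I) : Udepth psi = 0.
Proof. by elim: psi => //= a -> b ->. Qed.

Lemma truth_lemma phi : truth phi.
Proof.
(* Lexicographic induction: [n] bounds the U-depth and [m] the rank; the rank may grow whenever the
   U-depth drops. *)
have [n] := ubnP (Udepth phi); have [m] := ubnP (rank phi).
elim: n m phi => // n IHn; elim=> // m IHm phi rm un.
have IH psi : rank psi < rank phi -> Udepth psi <= Udepth phi -> truth psi.
  by move=> h k; apply: IHm; lia.
have IHU psi : Udepth psi < Udepth phi -> truth psi.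
  by move=> h; apply: (IHn (rank psi).+1) => //; lia.
case: phi {IHn IHm rm un} IH IHU => [p|a|a b|i a|psi a|i a] /= IH IHU.
- by [].
- by apply: truth_LNeg; apply: IH.
- by apply: truth_LAnd; apply: IH; lia.
- by apply: truth_LK; apply: IH.
- have rp := rank_gt0 psi.
  case: a IH IHU => [p|a|a b|i a|chi a|i a] /= IH IHU.
  + apply: truth_LIff (ax_ann_var _ _) _.
    by apply: truth_LImp => //; apply: IH; lia.
  + have ra := rank_gt0 a.
    apply: truth_LIff (ax_ann_neg _ _) _.
    by apply: truth_LImp; [|apply: truth_LNeg]; apply: IH => /=; nia.
  + have ra := rank_gt0 a; have rb := rank_gt0 b.
    apply: truth_LIff (ax_ann_and _ _ _) _.
    by apply: truth_LAnd; apply: IH => /=; nia.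
  + have ra := rank_gt0 a.
    apply: truth_LIff (ax_ann_K _ _ _) _.
    by apply: truth_LImp; [|apply: truth_LK]; apply: IH => /=; nia.
  + have ra := rank_gt0 a; have rc := rank_gt0 chi.
    apply: truth_LIff (ax_ann_ann _ _ _) _.
    by apply: IH => /=; nia.
  + apply: (truth_plug_LU (eta := AAnn psi (AHole _ _))) => chi.
    by apply: IHU; rewrite /= Udepth_EL; lia.
- apply: (truth_plug_LU (eta := AHole _ _)) => chi.
  by apply: IHU; rewrite /= Udepth_EL; lia.
Qed.

End Canonical.

(** * Soundness and completeness *)

Theorem mainTheorem1 (P : Type) (hP : exists f : nat -> P, bijective f)
    (I : finType) (phi : LUT P I) :
  provable phi <-> valid phi.
Proof.
have [f [g fK gK]] := hP.
split=> [|v]; first exact: (soundness (f 0)).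
apply: contrapT => np.
have code_inj := inj_comp (pcan_inj pickleK)
  (LUT_tree_inj (can_inj gK) (pcan_inj (@pickleK I))).
have T := @provable_theory P I.
(* The negation of a non-theorem is consistent, so some canonical state contains it. *)
have nn : ~ provable (LNeg (LNeg phi)) by move/(theory_dneg T).
have [D mD [Dn _]] := Lindenbaum code_inj T nn.
apply: (maxtheory_cons mD) Dn.
pose s : canonical_model mD := exist _ D mD.
exact: (proj1 (truth_lemma code_inj (f 0) phi s) (v _ s)).
Qed.
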